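(* Fix integers $h\ge1$, $w\ge2$, $K\ge1$. Let $\{\mathbf{y}_t\}$ be a weakly stationary, mean-zero $\mathbb{R}^w$-valued process, and consider $K$ candidate models: for $1\le\ell\le K$, $\mathbf{y}_{t+h}=\boldsymbol{\beta}_h(\ell)x_t(\ell)+\boldsymbol{\varepsilon}_t(\ell)$, where $\{x_t(\ell)\}$ is a weakly stationary mean-zero scalar process, $\boldsymbol{\beta}_h(\ell)\in\mathbb{R}^w$ is deterministic, and $R(\ell)=\mathbb{E}[x_1(\ell)^2]\ne0$. Suppose that for each $1\le\ell\le K$ and $0\le s\le h-1$, writing $x_t=x_t(\ell)$, $\boldsymbol{\varepsilon}_t=\boldsymbol{\varepsilon}_t(\ell)$, $R=R(\ell)$ and $\mathbf{C}_{h,s}=\mathbf{C}_{h,s}(\ell)=\mathbb{E}[(x_t\boldsymbol{\varepsilon}_t)(x_{t+s}\boldsymbol{\varepsilon}_{t+s})^\top]$, as $n\to\infty$: (1) $n^{-1}\sum_{t=1}^n\boldsymbol{\varepsilon}_t\boldsymbol{\varepsilon}_t^\top=\mathbb{E}[\boldsymbol{\varepsilon}_1\boldsymbol{\varepsilon}_1^\top]+O_p(n^{-1/2})$; (2) $n^{-1}\sum_{t=1}^n(x_t\boldsymbol{\varepsilon}_t)(x_{t+s}\boldsymbol{\varepsilon}_{t+s})^\top=\mathbf{C}_{h,s}+o_p(1)$; (3) $n^{-1/2}\sum_{t=1}^nx_t\boldsymbol{\varepsilon}_t=O_p(1)$; (4) $n^{-1}\sum_{t=1}^nx_t^2=R+o_p(1)$;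 (5) $\sup_{-\infty<t<\infty}\mathbb{E}[\|\boldsymbol{\varepsilon}_t\|^4]+\sup_{-\infty<t<\infty}\mathbb{E}[|x_t|^4]<\infty$. Let $\{\alpha_n\}$ be a sequence with $\alpha_n/\sqrt n\to+\infty$ and $\alpha_n/n\to0$, and let $\hat\ell_h$ be the model selected by the VMRIC, i.e. a minimizer over $1\le\ell\le K$ of $$\widehat{\mathrm{VMRIC}}_h(\ell)=\left\|\widehat{\mathbf{MI}}_h(\ell)\right\|+\left\|\frac{\alpha_n}{n}\widehat{\mathbf{VI}}_h(\ell)\right\|.$$ Then $$\lim_{n\to\infty}\Pr\left(\hat\ell_h\in M_2\right)=1,$$ where $$M_1=\left\{\kappa:1\le\kappa\le K,\ \|\mathbf{MI}_h(\kappa)\|=\min_{1\le\ell\le K}\|\mathbf{MI}_h(\ell)\|\right\},\qquad M_2=\left\{\kappa\in M_1:\ \|\mathbf{VI}_h(\kappa)\|=\min_{\ell\in M_1}\|\mathbf{VI}_h(\ell)\|\right\}.$$ That is, the VMRIC is asymptotically efficient.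
   Context: All processes are indexed by $t\in\mathbb{Z}$ on a common probability space; $h,w,K$ are fixed while $n\to\infty$, and $N=n-h$ (training set $[1,N]$, test set $[N+1,N+h]$). For each model $\ell$ (argument $\ell$ suppressed), $\boldsymbol{\varepsilon}_t=\boldsymbol{\varepsilon}_t^{(h)}:=\mathbf{y}_{t+h}-\boldsymbol{\beta}_hx_t$ and $$\mathbf{MI}_h=\mathbb{E}[\boldsymbol{\varepsilon}_t\boldsymbol{\varepsilon}_t^\top],\qquad \mathbf{VI}_h=R^{-1}\left(\mathbf{C}_{h,0}+\sum_{s=1}^{h-1}(\mathbf{C}_{h,s}+\mathbf{C}_{h,s}^\top)\right),$$ $$\widehat{\mathbf{MI}}_h=N^{-1}\sum_{t=1}^N\hat{\boldsymbol{\varepsilon}}_t\hat{\boldsymbol{\varepsilon}}_t^\top,\qquad \widehat{\mathbf{VI}}_h=\hat R^{-1}\left[\hat{\mathbf{C}}_{h,0}+\sum_{s=1}^{h-1}(\hat{\mathbf{C}}_{h,s}+\hat{\mathbf{C}}_{h,s}^\top)\right],$$ $\hat{\mathbf{C}}_{h,s}=(N-s)^{-1}\sum_{t=1}^{N-s}x_tx_{t+s}\hat{\boldsymbol{\varepsilon}}_t\hat{\boldsymbol{\varepsilon}}_{t+s}^\top$, $\hat R=N^{-1}\sum_{t=1}^Nx_t^2$, $\hat{\boldsymbol{\varepsilon}}_t=\mathbf{y}_{t+h}-\hat{\boldsymbol{\beta}}_n(h)x_t$, $\hat{\boldsymbol{\beta}}_n(h)=\hat R^{-1}\left(N^{-1}\sum_{t=1}^Nx_t\mathbf{y}_{t+h}\right)$.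 The notation for $\mathbf{C}_{h,s}$ and $\mathbf{MI}_h$ presupposes that these expectations do not depend on $t$. $\|\cdot\|$ is the Euclidean norm for vectors and the induced operator norm for matrices; $\mathbf{M}_n=o_p(c_n)$ (resp. $O_p(c_n)$) means $\|\mathbf{M}_n\|/c_n$ converges to $0$ in probability (resp. is bounded in probability). A model selection criterion is called asymptotically efficient if the model $\hat\ell_h$ it selects satisfies $\lim_{n\to\infty}\Pr(\hat\ell_h\in M_2)=1$. *)

(* Defs.v *)
From HB Require Import structures.
From mathcomp Require Import all_boot all_order all_algebra.
From mathcomp Require Import all_classical all_reals all_analysis.

Set Implicit Arguments.
Unset Strict Implicit.
Unset Printing Implicit Defensive.

Import Order.TTheory GRing.Theory Num.Theory.
Import numFieldNormedType.Exports.

Local Open Scope classical_set_scope.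
Local Open Scope ring_scope.

Section Norms.
Variable R : realType.

(* The library norm on matrices is the entrywise maximum, hence the two
   definitions below. *)
Definition enorm (m : nat) (v : 'cV[R]_m) : R :=
  Num.sqrt (\sum_(i < m) v i 0 ^+ 2).

Definition opnorm (m n : nat) (A : 'M[R]_(m, n)) : R :=
  sup [set enorm (A *m v) | v in [set v : 'cV[R]_n | enorm v <= 1]].

End Norms.

Definition argmin (R : realType) (I : Type) (A : set I) (f : I -> R) : set I :=
  [set k | A k /\ forall l, A l -> f k <= f l].

Section Probability.
Context {d : measure_display} {T : measurableType d} {R : realType}.
Variable P : probability T R.

(* X_n = o_p(c_n) and X_n = O_p(c_n) for real X_n >= 0; these are applied to
   norms of random vectors and matrices. *)
Definition is_op (X : nat -> T -> R) (c : nat -> R) : Prop :=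
  forall e : R, 0 < e ->
    P [set om | e < X n om / c n] @[n --> \oo] --> 0%E.

Definition is_Op (X : nat -> T -> R) (c : nat -> R) : Prop :=
  forall e : R, 0 < e -> exists2 A : R, 0 < A &
    \forall n \near \oo, (P [set om | (A < X n om / c n)%R] <= e%:E)%E.

(* Entrywise; [fine] is harmless only when the entries are integrable. *)
Definition expectation_mx (m n : nat) (M : T -> 'M[R]_(m, n)) : 'M[R]_(m, n) :=
  \matrix_(i, j) fine (expectation P (fun om => M om i j)).

(* Membership in [Lfun P 2] includes measurability. *)
Definition weakly_stationary (m : nat) (z : int -> T -> 'cV[R]_m) : Prop :=
  [/\ forall t i, (fun om => z t om i 0) \in Lfun P 2%:E,
      forall t t' i,
        expectation P (fun om => z t om i 0) =
        expectation P (fun om => z t' om i 0) &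
      forall t t' k i j,
        covariance P (fun om => z t om i 0) (fun om => z (t + k) om j 0) =
        covariance P (fun om => z t' om i 0) (fun om => z (t' + k) om j 0)].

Definition mean_zero (m : nat) (z : int -> T -> 'cV[R]_m) : Prop :=
  forall t i, expectation P (fun om => z t om i 0) = 0%E.

End Probability.

Section Model.
Context {d : measure_display} {T : measurableType d} {R : realType}.
Variables (P : probability T R) (h w : nat).
Variables (y : int -> T -> 'cV[R]_w) (x : int -> T -> R) (beta : 'cV[R]_w).

Definition err (t : int) (om : T) : 'cV[R]_w :=
  y (t + h%:Z) om - x t om *: beta.

Definition err2 (t : int) (om : T) : 'M[R]_w := err t om *m (err t om)^T.

Definition lagprod (s : nat) (t : int) (om : T) : 'M[R]_w :=
  (x t om *: err t om) *m (x (t + s%:Z) om *: err (t + s%:Z) om)^T.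

Definition Rpop : R := fine (expectation P (fun om => x 1 om ^+ 2)).

(* The expectations defining [MI] and [Cpop] are meant not to depend on the time
   index; they are taken at time 1 here, and time-invariance is required
   separately. *)
Definition MI : 'M[R]_w := expectation_mx P (err2 1).

Definition Cpop (s : nat) : 'M[R]_w := expectation_mx P (lagprod s 1).

Definition VI : 'M[R]_w :=
  Rpop^-1 *: (Cpop 0 + \sum_(1 <= s < h) (Cpop s + (Cpop s)^T)).

Definition time_invariant_moments : Prop :=
  (forall t, expectation_mx P (err2 t) = expectation_mx P (err2 1)) /\
  (forall s t, (s < h)%N ->
     expectation_mx P (lagprod s t) = expectation_mx P (lagprod s 1)).

Variables (n : nat) (om : T).

Let N := (n - h)%N.

Definition Rhat : R := N%:R^-1 * \sum_(1 <= t < N.+1) x t%:Z om ^+ 2.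

Definition betahat : 'cV[R]_w :=
  Rhat^-1 *:
    (N%:R^-1 *: \sum_(1 <= t < N.+1) x t%:Z om *: y (t%:Z + h%:Z) om).

Definition errhat (t : int) : 'cV[R]_w :=
  y (t + h%:Z) om - x t om *: betahat.

Definition MIhat : 'M[R]_w :=
  N%:R^-1 *: \sum_(1 <= t < N.+1) errhat t%:Z *m (errhat t%:Z)^T.

Definition Chat (s : nat) : 'M[R]_w :=
  (N - s)%:R^-1 *: \sum_(1 <= t < (N - s).+1)
    (x t%:Z om * x (t%:Z + s%:Z) om) *:
      (errhat t%:Z *m (errhat (t%:Z + s%:Z))^T).

Definition VIhat : 'M[R]_w :=
  Rhat^-1 *: (Chat 0 + \sum_(1 <= s < h) (Chat s + (Chat s)^T)).

Definition VMRIChat (alpha : nat -> R) : R :=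
  opnorm MIhat + opnorm ((alpha n / n%:R) *: VIhat).

End Model.

(* Main.v *)
Require Import Defs.
From HB Require Import structures.
From mathcomp Require Import all_boot all_order all_algebra.
From mathcomp Require Import all_classical all_reals all_analysis.
From mathcomp Require Import measurable_realfun zify ring lra.
Import Order.TTheory GRing.Theory Num.Theory.
Import numFieldNormedType.Exports.
Local Open Scope classical_set_scope.
Local Open Scope ring_scope.

(** Write [N = n - h], [S = N^-1 \sum_t x_t eps_t] for the score and
    [D = betahat - beta = Rhat^-1 S] for the estimation error; [cond3] and
    [cond4] give [D = O_p(n^-1/2)].

    The normal equations yield
      [MIhat = N^-1 \sum_t eps_t eps_t^T - Rhat^-1 S S^T]
    ([MIhatE]): by [cond1] this is [MI + O_p(n^-1/2)], an error negligible against
    the penalty weight [alpha_n / n] because [alpha_n / sqrt n] diverges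
    ([cvg_MIhat]). Replacing errors by residuals in an autocovariance adds terms
    linear and quadratic in [D], whose coefficients are averages of fourth-order
    products, hence O_p(1) by [cond5] and Markov's inequality
    ([Chat_dev_le], [cvg_moment4_avg]); so [Chat] and [VIhat] are consistent by
    [cond2] and [cond4] ([cvg_Chat], [cvg_VIhat]). Together,
      [VMRIChat = opnorm MI + alpha_n / n (opnorm VI + o_p(1))]
    ([cvg_VMRIChat]). Since [alpha_n / n] tends to 0, with probability tending
    to 1 a minimizer of the criterion over the finitely many models first
    minimizes [opnorm MI] and then, among ties, [opnorm VI]
    ([near_lexicographic_argmin]).

    Probabilistic limits are handled by a filter [inprob] on pairs (sample
    size, outcome): an o_p(1) sequence is one that converges to 0 along it, so
    the usual algebra of limits applies to stochastic expansions. An O_p(1)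
    sequence is used only through the fact that its product with any
    deterministic null sequence is o_p(1). Hypotheses [cond1] and [cond2] speak
    of probabilities of events defined by the operator norm, and extracting
    anything from them requires these events to be measurable: this is
    [measurable_opnorm]. *)

Set Implicit Arguments.
Unset Strict Implicit.
Unset Printing Implicit Defensive.

(** * Euclidean and operator norms *)

Section EuclideanNorm.
Variables (R : realType) (m : nat).
Implicit Types u v : 'cV[R]_m.

Lemma enorm_ge0 v : 0 <= enorm v.
Proof. exact: sqrtr_ge0. Qed.

Lemma enorm_sqr v : enorm v ^+ 2 = \sum_(i < m) v i 0 ^+ 2.
Proof. by rewrite sqr_sqrtr// sumr_ge0// => i _; exact: sqr_ge0. Qed.

Lemma enorm0 : enorm (0 : 'cV[R]_m) = 0.
Proof.
by rewrite /enorm big1 ?sqrtr0// => i _; rewrite mxE expr0n.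
Qed.

Lemma enormZ (c : R) v : enorm (c *: v) = `|c| * enorm v.
Proof.
rewrite /enorm -sqrtr_sqr -sqrtrM ?sqr_ge0//; congr Num.sqrt.
by rewrite mulr_sumr; apply: eq_bigr => i _; rewrite mxE exprMn.
Qed.

Lemma coord_le_enorm v i : `|v i 0| <= enorm v.
Proof.
rewrite -sqrtr_sqr ler_wsqrtr// (bigD1 i)//= lerDl sumr_ge0// => j _.
exact: sqr_ge0.
Qed.

Lemma enorm_cauchy_schwarz u v :
  \sum_(i < m) u i 0 * v i 0 <= enorm u * enorm v.
Proof.
have [u0|u0] := eqVneq (enorm u) 0.
  rewrite u0 mul0r big1// => i _.
  by have := coord_le_enorm u i; rewrite u0 normr_le0 => /eqP->; rewrite mul0r.
have [v0|v0] := eqVneq (enorm v) 0.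
  rewrite v0 mulr0 big1// => i _.
  by have := coord_le_enorm v i; rewrite v0 normr_le0 => /eqP->; rewrite mulr0.
set a := enorm u; set b := enorm v; set s := \sum_(i < m) _.
have ab0 : 0 < a * b by rewrite mulr_gt0// lt0r ?u0 ?v0 enorm_ge0.
have : 0 <= \sum_(i < m) (b * u i 0 - a * v i 0) ^+ 2.
  by rewrite sumr_ge0// => i _; exact: sqr_ge0.
have -> : \sum_(i < m) (b * u i 0 - a * v i 0) ^+ 2 =
    b ^+ 2 * \sum_(i < m) u i 0 ^+ 2 + a ^+ 2 * \sum_(i < m) v i 0 ^+ 2
    - 2 * (a * b) * s.
  rewrite /s !mulr_sumr -big_split/= -sumrB; apply: eq_bigr => i _; ring.
rewrite -!enorm_sqr -/a -/b.
have -> : b ^+ 2 * a ^+ 2 + a ^+ 2 * b ^+ 2 - 2 * (a * b) * s =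
          2 * (a * b) * (a * b - s) by ring.
have ab2 : 0 < 2 * (a * b) by rewrite mulr_gt0.
by rewrite (pmulr_rge0 _ ab2) subr_ge0.
Qed.

Lemma enormD u v : enorm (u + v) <= enorm u + enorm v.
Proof.
rewrite -(@ler_pXn2r _ 2)// ?nnegrE ?addr_ge0 ?enorm_ge0// sqrrD !enorm_sqr.
have -> : \sum_(i < m) (u + v) i 0 ^+ 2 =
    \sum_(i < m) u i 0 ^+ 2 + (\sum_(i < m) u i 0 * v i 0) *+ 2 +
    \sum_(i < m) v i 0 ^+ 2.
  rewrite -sumrMnl -!big_split/=; apply: eq_bigr => i _.
  by rewrite mxE sqrrD.
by rewrite lerD2r lerD2l lerMn2r enorm_cauchy_schwarz.
Qed.

Lemma enorm_le_sum v : enorm v <= \sum_(i < m) `|v i 0|.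
Proof.
have s0 : 0 <= \sum_(i < m) `|v i 0| by apply: sumr_ge0.
rewrite -(@ler_pXn2r _ 2)// ?nnegrE ?enorm_ge0// enorm_sqr expr2 mulr_suml.
apply: ler_sum => i _; rewrite -real_normK ?num_real// expr2 ler_wpM2l//.
rewrite (bigD1 i)//= lerDl.
exact: sumr_ge0.
Qed.

End EuclideanNorm.

Section OperatorNorm.
Variables (R : realType) (m n : nat).
Implicit Types A B : 'M[R]_(m, n).

Let entrysum A : R := \sum_(i < m) \sum_(j < n) `|A i j|.

Lemma enorm_mulmx_le A (v : 'cV[R]_n) :
  enorm v <= 1 -> enorm (A *m v) <= \sum_(i < m) \sum_(j < n) `|A i j|.
Proof.
move=> v1; apply: (le_trans (enorm_le_sum _)); apply: ler_sum => i _.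
rewrite mxE (le_trans (ler_norm_sum _ _ _))// ler_sum// => j _.
by rewrite normrM ler_piMr// (le_trans (coord_le_enorm _ _)).
Qed.

Lemma enorm_mulmx_le_opnorm A (v : 'cV[R]_n) :
  enorm v <= 1 -> enorm (A *m v) <= opnorm A.
Proof.
move=> v1; apply: ub_le_sup; last by exists v.
by exists (entrysum A) => _ [u u1 <-]; exact: enorm_mulmx_le.
Qed.

Lemma opnorm_le A (c : R) :
  (forall v : 'cV[R]_n, enorm v <= 1 -> enorm (A *m v) <= c) -> opnorm A <= c.
Proof.
move=> Ac; apply: ge_sup.
  by exists (enorm (A *m 0)), 0 => //=; rewrite enorm0.
by move=> _ [v v1 <-]; exact: Ac.
Qed.

Lemma opnorm_le_sum A : opnorm A <= \sum_(i < m) \sum_(j < n) `|A i j|.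
Proof. by apply: opnorm_le => v; exact: enorm_mulmx_le. Qed.

Lemma entry_le_opnorm A i j : `|A i j| <= opnorm A.
Proof.
have -> : A i j = (A *m (delta_mx j 0 : 'cV[R]_n)) i 0.
  rewrite mxE (bigD1 j)//= !mxE !eqxx mulr1 big1 ?addr0// => k kj.
  by rewrite mxE (negPf kj) mulr0.
apply: (le_trans (coord_le_enorm _ _)); apply: enorm_mulmx_le_opnorm.
rewrite /enorm (bigD1 j)//= mxE !eqxx big1 ?addr0 ?expr1n ?sqrtr1// => k kj.
by rewrite mxE (negPf kj) expr0n.
Qed.

Lemma opnorm_ge0 A : 0 <= opnorm A.
Proof.
by apply: le_trans (@enorm_mulmx_le_opnorm A 0 _);
  rewrite ?enorm_ge0 ?enorm0.
Qed.

Lemma opnormD A B : opnorm (A + B) <= opnorm A + opnorm B.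
Proof.
apply: opnorm_le => v v1; rewrite mulmxDl (le_trans (enormD _ _))//.
by rewrite lerD// enorm_mulmx_le_opnorm.
Qed.

Lemma opnormZ_le (c : R) A : opnorm (c *: A) <= `|c| * opnorm A.
Proof.
apply: opnorm_le => v v1; rewrite -scalemxAl enormZ ler_wpM2l//.
exact: enorm_mulmx_le_opnorm.
Qed.

Lemma opnorm0 : opnorm (0 : 'M[R]_(m, n)) = 0.
Proof.
apply/eqP; rewrite eq_le opnorm_ge0 andbT (le_trans (opnorm_le_sum _))//.
by rewrite big1// => i _; rewrite big1// => j _; rewrite mxE normr0.
Qed.

Lemma opnormZ (c : R) A : opnorm (c *: A) = `|c| * opnorm A.
Proof.
have [->|c0] := eqVneq c 0; first by rewrite scale0r opnorm0 normr0 mul0r.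
apply/eqP; rewrite eq_le opnormZ_le/=.
rewrite -{1}[A](scalerK c0) -ler_pdivlMl ?normr_gt0// -normfV.
exact: opnormZ_le.
Qed.

(** This Lipschitz bound gives both the measurability of the operator norm and
    its continuity under entrywise convergence. *)
Lemma opnorm_dist A B :
  `|opnorm A - opnorm B| <= \sum_(i < m) \sum_(j < n) `|A i j - B i j|.
Proof.
have le1 (C D : 'M[R]_(m, n)) :
    opnorm C - opnorm D <= \sum_(i < m) \sum_(j < n) `|C i j - D i j|.
  rewrite lerBlDl -{1}[C](subrKC D) (le_trans (opnormD _ _))// lerD2l.
  rewrite (le_trans (opnorm_le_sum _))// ler_sum// => i _; rewrite ler_sum//.
  by move=> j _; rewrite !mxE.
rewrite ler_norml le1 andbT lerNl opprB (le_trans (le1 _ _))//.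
by apply: ler_sum => i _; apply: ler_sum => j _; rewrite distrC.
Qed.

End OperatorNorm.

(** The set where [opnorm] exceeds [a] is open, hence a countable union of balls
    of rational centre and radius; a matrix-valued map with measurable entries
    has measurable preimages of such balls. *)
Lemma measurable_opnorm_gt (d : measure_display) (T : measurableType d)
    (R : realType) (m n : nat) (M : T -> 'M[R]_(m, n)) (a : R) :
  (forall i j, measurable_fun setT (fun om => M om i j)) ->
  measurable [set om | a < opnorm (M om)].
Proof.
move=> mM.
pose Q (q : 'M[rat]_(m, n)) : 'M[R]_(m, n) := map_mx ratr q.
pose D om q := \sum_(i < m) \sum_(j < n) `|M om i j - Q q i j|.
pose box (p : 'M[rat]_(m, n) * rat) : set T :=
  if a < opnorm (Q p.1) - ratr p.2 then [set om | D om p.1 < ratr p.2] else set0.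
have -> : [set om | a < opnorm (M om)] = \bigcup_p box p.
  apply/seteqP; split => [om /= aM|om [[q r] _]]; last first.
    rewrite /box/=; case: ifP => //= aQ Dr.
    have := opnorm_dist (M om) (Q q).
    by rewrite ler_norml -/(D om q) => /andP[]; lra.
  (* With [e] the slack, a centre at distance at most [e / 4] and a radius
     strictly between [e / 4] and [e / 2] make the ball stay where the norm
     exceeds [a]. *)
  pose e := opnorm (M om) - a; have e0 : 0 < e by rewrite /e subr_gt0.
  pose c : R := e / 4 / (m * n).+1%:R.
  have c0 : 0 < c by rewrite !divr_gt0.
  have qex i j : exists q : rat, `|M om i j - ratr q| < c.
    have /rat_in_itvoo[q /[!in_itv]/= /andP[q1 q2]] : M om i j - c < M om i j + c.
      by lra.
    by exists q; rewrite ltr_norml; lra.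
  pose q := \matrix_(i, j) projT1 (cid (qex i j)).
  have Dq : D om q <= e / 4.
    apply: (@le_trans _ _ (\sum_(i < m) \sum_(j < n) c)).
      apply: ler_sum => i _; apply: ler_sum => j _; rewrite !mxE.
      by case: cid => z /= /ltW.
    rewrite !sumr_const !card_ord -mulrnA mulnC /c -[leLHS]mulr_natr.
    have e4 : 0 <= e / 4 by rewrite divr_ge0// ltW.
    rewrite [leLHS]mulrAC ler_pdivrMr//.
    by rewrite ler_wpM2l// ler_nat.
  have /rat_in_itvoo[r /[!in_itv]/= /andP[r1 r2]] : e / 4 < e / 2 by lra.
  exists (q, r) => //; rewrite /box/= ifT/=; first exact: le_lt_trans r1.
  have := opnorm_dist (M om) (Q q).
  by rewrite ler_norml -/(D om q) => /andP[_]; rewrite /e in r1 r2 Dq *; lra.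
apply: countable_bigcupT_measurable => [|p].
  exact: countableP.
rewrite /box; case: ifP => // _.
have -> : [set om | D om p.1 < ratr p.2] =
    (fun om => D om p.1) @^-1` [set x | x < ratr p.2] by [].
rewrite -[X in measurable X]setTI.
have mD : measurable_fun setT (fun om => D om p.1).
  apply: measurable_sum => i; apply: measurable_sum => j.
  by apply: measurableT_comp => //; exact: measurable_funB.
by rewrite -set_itvE; apply: mD.
Qed.

Lemma measurable_opnorm (d : measure_display) (T : measurableType d)
    (R : realType) (m n : nat) (M : T -> 'M[R]_(m, n)) :
  (forall i j, measurable_fun setT (fun om => M om i j)) ->
  measurable_fun setT (fun om => opnorm (M om)).
Proof.
move=> mM; apply: (measurability _ (RGenOInfty.measurableE R)).
move=> _ [_ [a ->] <-].
rewrite setTI; have -> : (fun om => opnorm (M om)) @^-1` `]a, +oo[ =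
    [set om | a < opnorm (M om)].
  by apply/seteqP; split => om /=; rewrite in_itv/= andbT.
exact: measurable_opnorm_gt.
Qed.

Lemma measurable_enorm (d : measure_display) (T : measurableType d)
    (R : realType) (m : nat) (v : T -> 'cV[R]_m) :
  (forall i, measurable_fun setT (fun om => v om i 0)) ->
  measurable_fun setT (fun om => enorm (v om)).
Proof.
move=> mv; apply: (@measurableT_comp _ _ _ _ _ _ (@Num.sqrt R)).
  by apply: continuous_measurable_fun; exact: sqrt_continuous.
by apply: measurable_sum => i; exact: measurable_funX.
Qed.

(** * Convergence in probability as a filter *)

Section InProbability.
Context (d : measure_display) (T : measurableType d) (R : realType).
Variable P : probability T R.

(** These are the events of probability tending to 1. Only the exceptional sets
    [B] have to be measurable, so that [E] itself may be an event defined through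
    the selection criterion, whose measurability is never needed. *)
Definition inprob : set_system (nat * T) :=
  [set E | forall e : R, 0 < e -> \forall n \near \oo, exists B,
    [/\ measurable B, (P B <= e%:E)%E & forall om, ~ B om -> E (n, om)]].

#[global] Instance inprob_filter : Filter inprob.
Proof.
split.
- by move=> e e0; near=> n; exists set0; rewrite measure0 lee_fin ltW.
- move=> E F hE hF e e0; have e2 : 0 < e / 2 by rewrite divr_gt0.
  move: (hE _ e2) (hF _ e2); apply: filterS2 => n [B [mB PB BE]] [C [mC PC CF]].
  exists (B `|` C); split; first exact: measurableU.
    rewrite (le_trans (measureU2 _ _ _))//.
    by rewrite (splitr e) EFinD leeD.
  by move=> om /not_orP[nB nC]; split; [exact: BE|exact: CF].
- move=> E F EF hE e e0; move: (hE _ e0); apply: filterS => n [B [mB PB BE]].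
  by exists B; split => // om nB; apply/EF/BE.
Unshelve. all: by end_near. Qed.

Lemma inprob_shift (phi : nat -> nat) : phi n @[n --> \oo] --> \oo ->
  (phi p.1, p.2) @[p --> inprob] --> inprob.
Proof. by move=> phioo E hE e e0; exact: (phioo _ (hE e e0)). Qed.

Lemma cvg_inprob_fst : p.1 @[p --> inprob] --> \oo.
Proof.
move=> E hE e e0; apply: filterS hE => n En.
by exists set0; rewrite measure0 lee_fin ltW.
Qed.

Lemma near_inprob_gt (k : nat) : \forall p \near inprob, (k < p.1)%N.
Proof. exact: (cvg_inprob_fst (nbhs_infty_gt k)). Qed.

Lemma inprob_det (U : topologicalType) (u : nat -> U) (l : set_system U) :
  u n @[n --> \oo] --> l -> u p.1 @[p --> inprob] --> l.
Proof. by move=> ul; apply: cvg_comp ul; exact: cvg_inprob_fst. Qed.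

Lemma inprob_op (X : nat -> T -> R) :
  (forall n, measurable_fun setT (X n)) -> (forall n om, 0 <= X n om) ->
  is_op P X (fun=> 1) -> X p.1 p.2 @[p --> inprob] --> 0.
Proof.
move=> mX X0 opX; apply/cvgr0Pnorm_le => e e0 dl dl0.
have dlE : (0 < dl%:E)%E by rewrite lte_fin.
have /fine_cvgP[Pfin] := opX e e0.
move/cvgr_lt => /(_ _ dl0); apply: filterS2 Pfin => n fn Pn.
exists [set om | e < X n om / 1]; split.
- rewrite -[X in measurable X]setTI.
  by apply: measurable_fun_ltr => //; under eq_fun do rewrite divr1; exact: mX.
- by rewrite -(fineK fn) lee_fin ltW.
- by move=> om /= /negP; rewrite divr1 -leNgt ger0_norm.
Qed.

(** The only form in which boundedness in probability is used: it turns such a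
    hypothesis into limits along [inprob]. The map [phi] accounts for the
    observations lost to the horizon and the lags. *)
Lemma inprob_Op (X : nat -> T -> R) (c a : nat -> R) (phi : nat -> nat) :
  (forall n, measurable_fun setT (X n)) -> (forall n om, 0 <= X n om) ->
  (forall n, 0 <= c n) -> is_Op P X c ->
  phi n @[n --> \oo] --> \oo -> a n @[n --> \oo] --> 0 ->
  a p.1 * (X (phi p.1) p.2 / c (phi p.1)) @[p --> inprob] --> 0.
Proof.
move=> mX X0 c0 OpX phioo a0; apply/cvgr0Pnorm_le => e e0 dl dl0.
have [A A0 PA] := OpX _ dl0.
have eA : 0 < e / A by rewrite divr_gt0.
have PphiA : \forall n \near \oo,
    (P [set om | (A < X (phi n) om / c (phi n))%R] <= dl%:E)%E.
  exact: (phioo _ PA).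
have aA : \forall n \near \oo, `|a n| <= e / A.
  by move/cvgr0Pnorm_le : a0; exact.
apply: filterS2 PphiA aA => n PAn ean.
exists [set om | A < X (phi n) om / c (phi n)]; split => //.
- rewrite -[X in measurable X]setTI.
  by apply: measurable_fun_ltr => //; apply: measurable_funM.
- move=> om /= /negP; rewrite -leNgt => XA.
  rewrite normrM (@ger0_norm _ (_ / _)) ?divr_ge0//.
  by rewrite -(divfK (lt0r_neq0 A0) e) ler_pM ?divr_ge0.
Qed.

Lemma expectationD_le (f g : T -> R) (a b : \bar R) :
  measurable_fun setT f -> measurable_fun setT g ->
  (forall om, 0 <= f om) -> (forall om, 0 <= g om) ->
  (expectation P f <= a)%E -> (expectation P g <= b)%E ->
  (expectation P (f \+ g)%R <= a + b)%E.
Proof.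
move=> mf mg f0 g0; rewrite unlock => fa gb.
under eq_integral do rewrite EFinD.
rewrite ge0_integralD//.
- exact: leeD.
- by move=> om _; rewrite lee_fin.
- exact/measurable_EFinP.
- by move=> om _; rewrite lee_fin.
- exact/measurable_EFinP.
Qed.

Lemma expectation_average_le (W : nat -> T -> R) (C : R) (M : nat) :
  0 <= C -> (forall t, measurable_fun setT (W t)) ->
  (forall t om, 0 <= W t om) -> (forall t, (expectation P (W t) <= C%:E)%E) ->
  (expectation P (fun om => M%:R^-1 * \sum_(1 <= t < M.+1) W t om)%R <= C%:E)%E.
Proof.
move=> C0 mW W0 EW; rewrite unlock.
under eq_integral do rewrite EFinM -sumEFin.
have mWE t : measurable_fun setT (fun om => (W t om)%:E).
  exact/measurable_EFinP.
have WE0 t om : (0 <= (W t om)%:E)%E by rewrite lee_fin.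
rewrite ge0_integralZl//; last 2 first.
- exact: emeasurable_sum.
- by move=> om _; apply: sume_ge0.
rewrite ge0_integral_sum//.
apply: (@le_trans _ _ (M%:R^-1%:E * \sum_(1 <= t < M.+1) C%:E)%E).
  apply: lee_wpmul2l; first by rewrite lee_fin.
  by apply: lee_sum => t _; have := EW t; rewrite unlock.
rewrite sumEFin -EFinM lee_fin sumr_const_nat subn1/= -[C *+ M]mulr_natl mulrA.
by rewrite ler_piMl//; case: M => [|M]; rewrite ?mulr0// mulVf.
Qed.

(** By Markov's inequality these averages are O_p(1); the conclusion has the form
    of that of [inprob_Op]. *)
Lemma inprob_average (W : nat -> T -> R) (C : R) (a : nat -> R)
    (phi : nat -> nat) :
  0 <= C -> (forall t, measurable_fun setT (W t)) ->
  (forall t om, 0 <= W t om) -> (forall t, (expectation P (W t) <= C%:E)%E) ->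
  a n @[n --> \oo] --> 0 ->
  a p.1 * ((phi p.1)%:R^-1 * \sum_(1 <= t < (phi p.1).+1) W t p.2)
    @[p --> inprob] --> 0.
Proof.
move=> C0 mW W0 EW a0; apply/cvgr0Pnorm_le => e e0 dl dl0.
pose G M om : R := M%:R^-1 * \sum_(1 <= t < M.+1) W t om.
have mG M : measurable_fun setT (G M).
  by apply: measurable_funM => //; apply: measurable_sum => t.
have G0 M om : 0 <= G M om by rewrite mulr_ge0// sumr_ge0.
pose A := (C + 1) / dl; have A0 : 0 < A by rewrite divr_gt0// ltr_wpDl.
have eA : 0 < e / A by rewrite divr_gt0.
move/cvgr0Pnorm_le : a0 => /(_ _ eA); apply: filterS => n an.
exists [set om | A <= G (phi n) om]; split => //.
- rewrite -[X in measurable X]setTI; exact: measurable_fun_ler.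
- pose Gm : {mfun T >-> R} := mfun_Sub (mem_set (mG (phi n))).
  have /= := @markov _ _ _ P Gm idfun A A0 (@measurable_id _ _ _)
    (fun r => id) (fun _ _ _ _ => id).
  have -> : [set om | (A%:E <= `|(Gm om)%:E|)%E] = [set om | A <= G (phi n) om].
    by apply/seteqP; split => om /=; rewrite lee_fin ger0_norm.
  have -> : idfun \o (fun r : R => `|r|) \o Gm = G (phi n).
    by apply/funext => om /=; rewrite ger0_norm.
  move=> /le_trans/(_ (expectation_average_le _ C0 mW W0 EW)).
  have Bfin : P [set om | A <= G (phi n) om] \is a fin_num.
    rewrite fin_num_measure// -[X in measurable X]setTI.
    exact: measurable_fun_ler.
  rewrite -(fineK Bfin) -EFinM !lee_fin mulrC -ler_pdivlMr// => /le_trans; apply.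
  by rewrite ler_pdivrMr// /A mulrCA divff ?gt_eqF// mulr1 lerDl.
- move=> om /= /negP; rewrite -ltNge => GA.
  rewrite normrM (@ger0_norm _ (_ * _)) ?G0//.
  by rewrite -(divfK (lt0r_neq0 A0) e) ler_pM ?(ltW GA) ?G0.
Qed.

Lemma inprob_prob1 (E : nat -> set T) : (forall n, measurable (E n)) ->
  (\forall p \near inprob, E p.1 p.2) -> P (E n) @[n --> \oo] --> 1%E.
Proof.
move=> mE hE.
have Efin n : P (E n) \is a fin_num by exact: fin_num_measure.
apply/fine_cvgP; split; first by apply: nearW.
apply/cvgrPdist_le => e e0; have := hE e e0; apply: filterS => n [B [mB PB BE]].
have PE1 : fine (P (E n)) <= 1.
  by rewrite -lee_fin fineK// probability_le1.
rewrite /= ger0_norm ?subr_ge0// lerBlDr -lerBlDl.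
have : (P (~` B) <= P (E n))%E.
  by apply: le_measure; rewrite ?inE//; exact: measurableC.
have Bfin : P B \is a fin_num by exact: fin_num_measure.
rewrite probability_setC// -(fineK (Efin n)) -(fineK Bfin) -EFinB lee_fin.
apply: le_trans; rewrite lerD2l lerN2 -lee_fin fineK//.
Qed.

End InProbability.

(** * Limits along a filter and elementary inequalities *)

Lemma cvg_near_eq (T : Type) (U : topologicalType) (F : set_system T)
    {FF : Filter F} (f g : T -> U) (l : U) :
  g @ F --> l -> (\forall p \near F, f p = g p) -> f @ F --> l.
Proof.
move=> gl fg; apply: cvg_trans gl; apply: near_eq_cvg.
by apply: filterS fg => p ->.
Qed.

Lemma cvg_finite_sum (T : Type) (R : realType) (F : set_system T) {FF : Filter F}
    (I : Type) (r : seq I) (f : I -> T -> R) (l : I -> R) :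
  (forall i, f i @ F --> l i) ->
  \sum_(i <- r) f i p @[p --> F] --> \sum_(i <- r) l i.
Proof. by move=> fl; apply: cvg_big => //; exact: add_continuous. Qed.

Lemma cvg_finite_sum0 (T : Type) (R : realType) (F : set_system T) {FF : Filter F}
    (I : Type) (r : seq I) (f : I -> T -> R) :
  (forall i, f i @ F --> 0) -> \sum_(i <- r) f i p @[p --> F] --> 0.
Proof.
move=> f0; have := cvg_finite_sum (r := r) (l := fun=> 0) f0.
by rewrite big1_eq; exact.
Qed.

Lemma cvg0_dominated (T : Type) (R : realType) (F : set_system T)
    {FF : Filter F} (f g : T -> R) :
  (\forall p \near F, `|f p| <= g p) -> g @ F --> 0 -> f @ F --> 0.
Proof.
move=> fg /cvgr0Pnorm_le g0; apply/cvgr0Pnorm_le => e /g0.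
apply: filterS2 fg => p fg; apply: le_trans.
by rewrite (le_trans fg)// ler_norm.
Qed.

Lemma mulmx_trcvE (R : realType) (m n : nat) (u : 'cV[R]_m) (v : 'cV[R]_n) i j :
  (u *m v^T) i j = u i 0 * v j 0.
Proof. by rewrite mxE big_ord1 mxE. Qed.

(** The weight [a] makes the lemma cover rates of convergence. *)
Lemma cvg_opnorm (T : Type) (R : realType) (F : set_system T) {FF : Filter F}
    (m n : nat) (M : T -> 'M[R]_(m, n)) (L : 'M[R]_(m, n)) (a : T -> R) :
  (forall i j, a p * (M p i j - L i j) @[p --> F] --> 0) ->
  a p * (opnorm (M p) - opnorm L) @[p --> F] --> 0.
Proof.
move=> ML.
apply: (@cvg0_dominated _ _ _ _ _
  (fun p => \sum_(i < m) \sum_(j < n) `|a p * (M p i j - L i j)|)).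
  apply: nearW => p.
  rewrite normrM (le_trans (ler_wpM2l (normr_ge0 _) (opnorm_dist _ _)))//.
  rewrite mulr_sumr ler_sum// => i _; rewrite mulr_sumr ler_sum// => j _.
  by rewrite normrM.
apply: cvg_finite_sum0 => i; apply: cvg_finite_sum0 => j.
by rewrite -(@normr0 _ R); exact: cvg_norm.
Qed.

Lemma sum_residual_mul (R : comRingType) (r : seq nat) (e f x : nat -> R) (a b : R) :
  \sum_(t <- r) (e t - x t * a) * (f t - x t * b) =
  \sum_(t <- r) e t * f t - b * (\sum_(t <- r) x t * e t)
  - a * (\sum_(t <- r) x t * f t) + a * b * (\sum_(t <- r) x t ^+ 2).
Proof.
rewrite !mulr_sumr -!sumrB -big_split/=; apply: eq_bigr => t _; ring.
Qed.

(** The factor 4 matters for products with repeated factors: each repetition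
    costs one more copy of a fourth power, and there are at most four. *)
Lemma mul4_le_sum_pow4 (R : realType) (a b c d : R) :
  0 <= a -> 0 <= b -> 0 <= c -> 0 <= d ->
  4 * (a * b * c * d) <= a ^+ 4 + b ^+ 4 + c ^+ 4 + d ^+ 4.
Proof.
move=> a0 b0 c0 d0; rewrite -subr_ge0.
have -> : a ^+ 4 + b ^+ 4 + c ^+ 4 + d ^+ 4 - 4 * (a * b * c * d) =
  (a ^+ 2 - b ^+ 2) ^+ 2 + (c ^+ 2 - d ^+ 2) ^+ 2 + 2 * (a * b - c * d) ^+ 2.
  by ring.
apply: addr_ge0; first by rewrite addr_ge0 ?sqr_ge0.
by rewrite mulr_ge0 ?sqr_ge0.
Qed.

(** * Algebra of the estimators *)

Section Algebra.
Context (d : measure_display) (T : measurableType d) (R : realType).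
Variables (h w : nat).
Variables (y : int -> T -> 'cV[R]_w) (x : int -> T -> R) (beta : 'cV[R]_w).

Definition score (n : nat) (om : T) : 'cV[R]_w :=
  n%:R^-1 *: \sum_(1 <= t < n.+1) x t%:Z om *: err h y x beta t%:Z om.

Lemma scoreE n om i : score n om i 0 =
  n%:R^-1 * \sum_(1 <= t < n.+1) x t%:Z om * err h y x beta t%:Z om i 0.
Proof.
by rewrite mxE summxE; congr (_ * _); apply: eq_bigr => t _; rewrite mxE.
Qed.

Lemma lagprodE s t om i j : lagprod h y x beta s t om i j =
  x t om * err h y x beta t om i 0 *
  (x (t + s%:Z) om * err h y x beta (t + s%:Z) om j 0).
Proof. by rewrite /lagprod mulmx_trcvE mxE; congr (_ * _); rewrite mxE. Qed.

Definition betahat_dev (n : nat) (om : T) : 'cV[R]_w :=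
  (Rhat h x n om)^-1 *: score (n - h) om.

Lemma betahatE n om : Rhat h x n om != 0 ->
  betahat h y x n om = beta + betahat_dev n om.
Proof.
move=> r0; rewrite /betahat /betahat_dev /score.
have -> : \sum_(1 <= t < (n - h).+1) x t%:Z om *: y (t%:Z + h%:Z) om =
    \sum_(1 <= t < (n - h).+1) x t%:Z om *: err h y x beta t%:Z om +
    (\sum_(1 <= t < (n - h).+1) x t%:Z om ^+ 2) *: beta.
  rewrite scaler_suml -big_split/=; apply: eq_bigr => t _.
  by rewrite /err scalerBr scalerA -expr2 subrK.
rewrite [in LHS]scalerDr (scalerA (n - h)%:R^-1) -/(Rhat h x n om).
by rewrite scalerDr (scalerA _ (Rhat h x n om)) mulVf// scale1r addrC.
Qed.

Lemma errhatE n om t i : Rhat h x n om != 0 ->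
  errhat h y x n om t i 0 =
  err h y x beta t om i 0 - x t om * betahat_dev n om i 0.
Proof.
move=> r0; rewrite /errhat betahatE// /err !mxE; ring.
Qed.

(** Least squares makes the two cross terms and the quadratic term combine into a
    single correction, quadratic in the score. *)
Lemma MIhatE n om i j : Rhat h x n om != 0 ->
  MIhat h y x n om i j =
  (n - h)%:R^-1 * (\sum_(1 <= t < (n - h).+1) err2 h y x beta t%:Z om i j)
  - (Rhat h x n om)^-1 * score (n - h) om i 0 * score (n - h) om j 0.
Proof.
move=> r0; rewrite mxE summxE; set r := Rhat h x n om.
under eq_bigr do rewrite mulmx_trcvE !errhatE//.
under [in RHS]eq_bigr do rewrite /err2 mulmx_trcvE.
rewrite (sum_residual_mul _ (fun t => err h y x beta t%:Z om i 0)
  (fun t => err h y x beta t%:Z om j 0) (fun t => x t%:Z om)).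
have DE k : betahat_dev n om k 0 = r^-1 * score (n - h) om k 0 by rewrite mxE.
rewrite !DE mulrDr !mulrBr.
rewrite (mulrCA _ (r^-1 * score _ om j 0)) (mulrCA _ (r^-1 * score _ om i 0)).
rewrite (mulrCA _ (r^-1 * _ * _)) -[_ * (\sum_(_ <= _ < _) _ ^+ 2)]/r.
rewrite -!scoreE; move: ((n - h)%:R^-1) => q; field.
exact: r0.
Qed.

(** By the arithmetic-geometric inequality, every product of four factors among
    regressors and error coordinates at times [t] and [t + s] is at most
    [moment4 t + moment4 (t + s)]. *)
Definition moment4 (t : int) (om : T) : R :=
  `|x t om| ^+ 4 + enorm (err h y x beta t om) ^+ 4.

Definition moment4_avg (s M : nat) (om : T) : R :=
  M%:R^-1 * \sum_(1 <= t < M.+1) (moment4 t%:Z om + moment4 (t%:Z + s%:Z) om).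

Lemma moment4_ge0 t om : 0 <= moment4 t om.
Proof. by rewrite addr_ge0// exprn_ge0// enorm_ge0. Qed.

(** Since [errhat = eps - x D], expanding the product of two residuals leaves the
    product of the errors plus terms linear or quadratic in [D] whose
    coefficients are fourth-order products. *)
Lemma Chat_dev_le n om s i j : Rhat h x n om != 0 ->
  let M := (n - h - s)%N in let D := betahat_dev n om in
  `|Chat h y x n om s i j -
    M%:R^-1 * \sum_(1 <= t < M.+1) lagprod h y x beta s t%:Z om i j| <=
  moment4_avg s M om * `|D j 0| + moment4_avg s M om * `|D i 0| +
  moment4_avg s M om * `|D i 0| * `|D j 0|.
Proof.
move=> r0 /=; set M := (n - h - s)%N; set D := betahat_dev n om; rewrite mxE summxE -/M -mulrBr -sumrB.
rewrite normrM ger0_norm ?invr_ge0//.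
rewrite /moment4_avg -!mulrA -!mulrDr ler_wpM2l ?invr_ge0//.
rewrite mulr_suml; apply: (le_trans (ler_norm_sum _ _ _)).
apply: ler_sum => t _; rewrite mxE mulmx_trcvE !errhatE// -/D.
rewrite lagprodE.
set a := x t%:Z om; set b := x _ om; set e := err h y x beta _ _ i 0.
set f := err h y x beta _ _ j 0; set u := D i 0; set v := D j 0.
set W := moment4 _ _ + moment4 _ _.
have -> : a * b * ((e - a * u) * (f - b * v)) - a * e * (b * f) =
  - (a * b * b * e * v) - (a * a * b * f * u) + a * a * b * b * (u * v) by ring.
have eW : `|e| ^+ 4 <= enorm (err h y x beta t%:Z om) ^+ 4.
  by rewrite lerXn2r ?nnegrE ?enorm_ge0// coord_le_enorm.
have fW : `|f| ^+ 4 <= enorm (err h y x beta (t%:Z + s%:Z) om) ^+ 4.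
  by rewrite lerXn2r ?nnegrE ?enorm_ge0// coord_le_enorm.
have a0 : 0 <= `|a| ^+ 4 by rewrite exprn_ge0.
have b0 : 0 <= `|b| ^+ 4 by rewrite exprn_ge0.
have e0 : 0 <= `|e| ^+ 4 by rewrite exprn_ge0.
have f0 : 0 <= `|f| ^+ 4 by rewrite exprn_ge0.
have WE : W = `|a| ^+ 4 + enorm (err h y x beta t%:Z om) ^+ 4 +
  (`|b| ^+ 4 + enorm (err h y x beta (t%:Z + s%:Z) om) ^+ 4) by [].
have W1 : `|a * b * b * e| <= W.
  rewrite !normrM; have := @mul4_le_sum_pow4 R `|a| `|b| `|b| `|e|.
  by move=> /(_ (normr_ge0 _) (normr_ge0 _) (normr_ge0 _) (normr_ge0 _)); lra.
have W2 : `|a * a * b * f| <= W.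
  rewrite !normrM; have := @mul4_le_sum_pow4 R `|a| `|a| `|b| `|f|.
  by move=> /(_ (normr_ge0 _) (normr_ge0 _) (normr_ge0 _) (normr_ge0 _)); lra.
have W3 : `|a * a * b * b| <= W.
  rewrite !normrM; have := @mul4_le_sum_pow4 R `|a| `|a| `|b| `|b|.
  by move=> /(_ (normr_ge0 _) (normr_ge0 _) (normr_ge0 _) (normr_ge0 _)); lra.
rewrite !mulrDr (le_trans (ler_normD _ _))// lerD//.
  rewrite (le_trans (ler_normB _ _))// normrN !(normrM (_ * _ * _ * _)).
  by rewrite lerD// ler_wpM2r.
by rewrite (normrM (_ * _ * _ * _)) (normrM u) ler_wpM2r// mulr_ge0.
Qed.

End Algebra.

(** * Deterministic rates and consistency of the estimators *)

Section Rates.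
Context (R : realType).

Lemma cvg_sqrt_pinfty (f : nat -> R) :
  f n @[n --> \oo] --> +oo -> Num.sqrt (f n) @[n --> \oo] --> +oo.
Proof.
move=> /cvgryPge foo; apply/cvgryPge => A.
have := foo (A ^+ 2); apply: filterS => n A2.
by rewrite (le_trans (ler_norm A))// -sqrtr_sqr ler_wsqrtr.
Qed.

Lemma cvg_inv_pinfty (f : nat -> R) :
  f n @[n --> \oo] --> +oo -> (f n)^-1 @[n --> \oo] --> 0.
Proof.
move=> foo; apply/gtr0_cvgV0 => //; by move/cvgryPgt : foo; apply.
Qed.

Lemma cvg_natr_subn (k : nat) : ((n - k)%:R : R) @[n --> \oo] --> +oo.
Proof. by apply: (cvg_comp _ _ (cvg_subnr k)); exact: cvgr_idn. Qed.

(** Dropping the last [k] observations does not change rates, because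
    [sqrt n <= 2 sqrt (n - k)] eventually. *)
Lemma cvg_penalty_rate (alpha : nat -> R) (k : nat) :
  alpha n / Num.sqrt n%:R @[n --> \oo] --> +oo ->
  n%:R / alpha n / Num.sqrt (n - k)%:R @[n --> \oo] --> 0.
Proof.
move=> aoo.
have a0 : \forall n \near \oo, 0 < alpha n / Num.sqrt n%:R.
  by move/cvgryPgt : aoo; apply.
apply: (@cvg0_dominated _ _ _ _ _ (fun n => 2 * (alpha n / Num.sqrt n%:R)^-1)).
  have nk : \forall n \near \oo, (2 * k < n)%N by exact: nbhs_infty_gt.
  apply: filterS2 a0 nk => n an kn.
  have sn : 0 < Num.sqrt n%:R :> R by rewrite sqrtr_gt0 ltr0n; lia.
  have sk : 0 < Num.sqrt (n - k)%:R :> R by rewrite sqrtr_gt0 ltr0n; lia.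
  have aln : 0 < alpha n by move: an; rewrite pmulr_lgt0// invr_gt0.
  rewrite ger0_norm ?divr_ge0 ?(ltW aln) ?(ltW sk)//.
  rewrite invf_div mulrA ler_pdivrMr// mulrAC ler_pM2r ?invr_gt0//.
  rewrite -{1}[n%:R]sqr_sqrtr// expr2 -[2 * _]mulrC -mulrA ler_pM2l//.
  rewrite -[2]ger0_norm// -sqrtr_sqr -sqrtrM ?sqr_ge0// ler_wsqrtr//.
  by rewrite -natrX -natrM ler_nat; lia.
rewrite -(mulr0 2); apply: cvgMl_tmp; exact: cvg_inv_pinfty.
Qed.

End Rates.

Section Consistency.
Context (d : measure_display) (T : measurableType d) (R : realType).
Variables (P : probability T R) (h w : nat).
Variables (y : int -> T -> 'cV[R]_w) (x : int -> T -> R) (beta : 'cV[R]_w).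

Local Notation F := (inprob P).
Let eps := err h y x beta.
Let r p := Rhat h x p.1 p.2.

Hypothesis my : forall t i, measurable_fun setT (fun om => y t om i 0).
Hypothesis mx : forall t, measurable_fun setT (x t).
Hypothesis R_neq0 : Rpop P x <> 0.
Hypothesis err2_rate :
  is_Op P (fun n om => opnorm (n%:R^-1 *:
      \sum_(1 <= t < n.+1) err2 h y x beta t%:Z om - MI P h y x beta))
    (fun n => (Num.sqrt n%:R)^-1).
Hypothesis lagprod_lln : forall s : nat, (s <= h - 1)%N ->
  is_op P (fun n om => opnorm (n%:R^-1 *:
      \sum_(1 <= t < n.+1) lagprod h y x beta s t%:Z om - Cpop P h y x beta s))
    (fun=> 1).
Hypothesis score_rate :
  is_Op P (fun n om => enorm ((Num.sqrt n%:R)^-1 *: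
      \sum_(1 <= t < n.+1) x t%:Z om *: err h y x beta t%:Z om))
    (fun=> 1).
Hypothesis Rhat_lln :
  is_op P (fun n om =>
      `| n%:R^-1 * (\sum_(1 <= t < n.+1) x t%:Z om ^+ 2) - Rpop P x |)
    (fun=> 1).
Hypothesis moments_bounded :
  (ereal_sup [set expectation P (fun om => enorm (eps t om) ^+ 4)%R
                | t in [set: int]]
   + ereal_sup [set expectation P (fun om => `| x t om | ^+ 4)%R
                | t in [set: int]]
   < +oo)%E.

Lemma measurable_err t i : measurable_fun setT (fun om => eps t om i 0).
Proof.
have -> : (fun om => eps t om i 0) =
    (fun om => y (t + h%:Z) om i 0 - x t om * beta i 0).
  by apply/funext => om; rewrite /eps /err !mxE.
by apply: measurable_funB => //; exact: measurable_funM.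
Qed.

Lemma cvg_Rhat : r p @[p --> F] --> Rpop P x.
Proof.
pose X n om : R :=
  `| n%:R^-1 * (\sum_(1 <= t < n.+1) x t%:Z om ^+ 2) - Rpop P x |.
have mX n : measurable_fun setT (X n).
  apply: measurableT_comp => //; apply: measurable_funB => //.
  apply: measurable_funM => //; apply: measurable_sum => t.
  exact: measurable_funX.
have /(cvg_comp _ _ (inprob_shift (cvg_subnr h))) X0 :=
  inprob_op mX (fun _ _ => normr_ge0 _) Rhat_lln.
by apply/subr_cvg0/norm_cvg0P.
Qed.

Lemma near_Rhat_neq0 : \forall p \near F, r p != 0.
Proof. have R0 : Rpop P x != 0 by exact/eqP.
exact: (cvgr_neq0 _ cvg_Rhat R0). Qed.

Lemma cvg_Rhat_inv : (r p)^-1 @[p --> F] --> (Rpop P x)^-1.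
Proof. by apply: cvgV; [exact/eqP|exact: cvg_Rhat]. Qed.

Lemma cvg_lagprod_avg s i j : (s < h)%N ->
  (p.1 - h - s)%:R^-1 *
    (\sum_(1 <= t < (p.1 - h - s).+1) lagprod h y x beta s t%:Z p.2 i j)
  @[p --> F] --> Cpop P h y x beta s i j.
Proof.
move=> sh; pose X n om := opnorm (n%:R^-1 *:
  \sum_(1 <= t < n.+1) lagprod h y x beta s t%:Z om - Cpop P h y x beta s).
have mX n : measurable_fun setT (X n).
  apply: measurable_opnorm => a b.
  under eq_fun do rewrite mxE mxE summxE mxE.
  apply: measurable_funB => //; apply: measurable_funM => //.
  apply: measurable_sum => t; under eq_fun do rewrite lagprodE.
  by apply: measurable_funM; apply: measurable_funM => //; exact: measurable_err.
have shift : (n - h - s)%N @[n --> \oo] --> \oo.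
  by have := cvg_comp _ _ (cvg_subnr h) (cvg_subnr s).
have sh1 : (s <= h - 1)%N by lia.
have /(cvg_comp _ _ (inprob_shift shift)) X0 :=
  inprob_op mX (fun _ _ => opnorm_ge0 _) (lagprod_lln sh1).
apply/subr_cvg0; apply: cvg0_dominated X0; apply: nearW => p /=.
by apply: le_trans (entry_le_opnorm _ i j); rewrite !mxE summxE.
Qed.

Lemma cvg_err2_avg (a : nat -> R) i j :
  a n / Num.sqrt (n - h)%:R @[n --> \oo] --> 0 ->
  a p.1 * ((p.1 - h)%:R^-1 *
    (\sum_(1 <= t < (p.1 - h).+1) err2 h y x beta t%:Z p.2 i j)
    - MI P h y x beta i j) @[p --> F] --> 0.
Proof.
move=> a0; pose X n om := opnorm (n%:R^-1 *:
  \sum_(1 <= t < n.+1) err2 h y x beta t%:Z om - MI P h y x beta).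
have mX n : measurable_fun setT (X n).
  apply: measurable_opnorm => k l.
  under eq_fun do rewrite mxE mxE summxE mxE.
  apply: measurable_funB => //; apply: measurable_funM => //.
  apply: measurable_sum => t; under eq_fun do rewrite mulmx_trcvE.
  by apply: measurable_funM; exact: measurable_err.
have na0 : `|a n / Num.sqrt (n - h)%:R| @[n --> \oo] --> 0.
  by rewrite -(@normr0 _ R); exact: cvg_norm.
have sqrtV0 (n : nat) : 0 <= (Num.sqrt n%:R)^-1 :> R.
  by rewrite invr_ge0 sqrtr_ge0.
have := inprob_Op mX (fun _ _ => opnorm_ge0 _) sqrtV0 err2_rate
  (cvg_subnr h) na0.
apply: cvg0_dominated.
apply: (filterS _ (near_inprob_gt P h)) => p hp.
have sp : 0 < Num.sqrt (p.1 - h)%:R :> R by rewrite sqrtr_gt0 ltr0n subn_gt0.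
rewrite !normrM normfV (ger0_norm (ltW sp)) invrK (mulrC (X _ _)) mulrA.
rewrite divfK ?gt_eqF// ler_wpM2l//.
by apply: le_trans (entry_le_opnorm _ i j); rewrite !mxE summxE.
Qed.

Lemma cvg_score (a : nat -> R) i :
  a n / Num.sqrt (n - h)%:R @[n --> \oo] --> 0 ->
  a p.1 * score h y x beta (p.1 - h) p.2 i 0 @[p --> F] --> 0.
Proof.
move=> a0; pose X n om := enorm ((Num.sqrt n%:R)^-1 *:
  \sum_(1 <= t < n.+1) x t%:Z om *: err h y x beta t%:Z om).
have mX n : measurable_fun setT (X n).
  apply: measurable_enorm => k.
  under eq_fun do rewrite mxE summxE.
  apply: measurable_funM => //; apply: measurable_sum => t.
  under eq_fun do rewrite mxE.
  by apply: measurable_funM => //; exact: measurable_err.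
have na0 : `|a n / Num.sqrt (n - h)%:R| @[n --> \oo] --> 0.
  by rewrite -(@normr0 _ R); exact: cvg_norm.
have := inprob_Op mX (fun _ _ => enorm_ge0 _) (fun=> ler01) score_rate
  (cvg_subnr h) na0.
apply: cvg0_dominated; apply: nearW => p /=.
rewrite divr1 -enormZ.
apply: le_trans (coord_le_enorm _ i); rewrite /score scalerA !mxE.
by rewrite -(mulrA (a _)) -invfM -expr2 sqr_sqrtr// mulrA.
Qed.

Lemma cvg_betahat_dev (a : nat -> R) i :
  a n / Num.sqrt (n - h)%:R @[n --> \oo] --> 0 ->
  a p.1 * betahat_dev h y x beta p.1 p.2 i 0 @[p --> F] --> 0.
Proof.
move=> a0; pose proof (cvgM cvg_Rhat_inv (cvg_score i a0)) as Da0.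
rewrite mulr0 in Da0.
apply: (cvg_near_eq Da0); apply: nearW => p.
by rewrite /= /betahat_dev mxE mulrCA.
Qed.

Lemma cvg_moment4_avg (a : nat -> R) s :
  a n @[n --> \oo] --> 0 ->
  a p.1 * moment4_avg h y x beta s (p.1 - h - s) p.2 @[p --> F] --> 0.
Proof.
move: moments_bounded; set S1 := ereal_sup _; set S2 := ereal_sup _ => Soo.
have m1 t : measurable_fun setT (fun om => `|x t om| ^+ 4).
  by apply: measurable_funX; exact: measurableT_comp.
have m2 t : measurable_fun setT (fun om => enorm (eps t om) ^+ 4).
  by apply: measurable_funX; apply: measurable_enorm => i; exact: measurable_err.
have mV t : measurable_fun setT (moment4 h y x beta t) by exact: measurable_funD.
have V0 := moment4_ge0 h y x beta.
have EV t : (expectation P (moment4 h y x beta t) <= S2 + S1)%E.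
  apply: (@expectationD_le _ _ _ P (fun om => `|x t om| ^+ 4)
    (fun om => enorm (eps t om) ^+ 4) _ _) => //.
  - by move=> om; rewrite exprn_ge0// enorm_ge0.
  - by apply: ereal_sup_ubound; exists t.
  - by apply: ereal_sup_ubound; exists t.
have S0 : (0 <= S2 + S1)%E.
  by apply: le_trans (EV 0); exact: expectation_ge0.
have Sfin : (S2 + S1)%E \is a fin_num.
  by rewrite ge0_fin_numE// addeC.
move=> a0.
apply: (@inprob_average _ _ _ P
  (fun t om => moment4 h y x beta t%:Z om + moment4 h y x beta (t%:Z + s%:Z) om)
  (fine (S2 + S1) + fine (S2 + S1)) a (fun n => n - h - s)%N) => //.
- by rewrite addr_ge0// fine_ge0.
- by move=> t; exact: measurable_funD.
- by move=> t om; rewrite addr_ge0.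
- by move=> t; rewrite EFinD fineK//; exact: expectationD_le.
Qed.

(* [q n] is [N^(-1/4)], the square root of the rate of the estimation error. *)
Let q n : R := (Num.sqrt (Num.sqrt (n - h)%:R))^-1.

(** The estimation error is [n^-1/2 O_p(1)] and its coefficients are O_p(1):
    splitting the rate evenly between the two factors makes both vanish. *)
Lemma cvg_Chat s i j : (s < h)%N ->
  Chat h y x p.1 p.2 s i j @[p --> F] --> Cpop P h y x beta s i j.
Proof.
move=> sh.
pose D k (p : nat * T) := betahat_dev h y x beta p.1 p.2 k 0.
pose G (p : nat * T) := moment4_avg h y x beta s (p.1 - h - s) p.2.
have q0 : q n @[n --> \oo] --> 0.
  apply: cvg_inv_pinfty; do 2 apply: cvg_sqrt_pinfty.
  exact: cvg_natr_subn.
have qD k : (q p.1)^-1 * D k p @[p --> F] --> 0.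
  apply: (@cvg_betahat_dev (fun n => (q n)^-1)); rewrite (_ : (fun n => _) = q)//.
  apply/funext => n; rewrite /q invrK.
  set u := Num.sqrt (Num.sqrt _).
  rewrite -[X in u / X]sqr_sqrtr ?sqrtr_ge0// -/u expr2 invfM mulrA.
  by have [->|u0] := eqVneq u 0; rewrite ?mul0r ?invr0// divff// mul1r.
have D0 k : D k p @[p --> F] --> 0.
  have sqrtV0 : 1 / Num.sqrt (n - h)%:R @[n --> \oo] --> (0 : R).
    under eq_cvg do rewrite div1r.
    by apply: cvg_inv_pinfty; apply: cvg_sqrt_pinfty; exact: cvg_natr_subn.
  apply: (cvg_near_eq (@cvg_betahat_dev (fun=> 1) k sqrtV0)).
  by apply: nearW => p; rewrite mul1r.
have GD k : G p * `|D k p| @[p --> F] --> 0.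
  pose proof (cvgM (cvg_moment4_avg s q0) (cvg_norm (qD k))) as GD0.
  rewrite mul0r in GD0; apply: (cvg_near_eq GD0).
  apply: (filterS _ (near_inprob_gt P h)) => p hp /=.
  have qp : 0 < q p.1 by rewrite invr_gt0 !sqrtr_gt0 ltr0n subn_gt0.
  have qV : 0 <= (q p.1)^-1 by rewrite invr_ge0 ltW.
  by rewrite normrM (ger0_norm qV) mulrACA divff ?mul1r// gt_eqF.
have GDD : G p * `|D i p| * `|D j p| @[p --> F] --> 0.
  pose proof (cvgM (GD i) (cvg_norm (D0 j))) as GDD.
  by rewrite mul0r in GDD.
pose L (p : nat * T) := (p.1 - h - s)%:R^-1 *
    (\sum_(1 <= t < (p.1 - h - s).+1) lagprod h y x beta s t%:Z p.2 i j).
have CL : Chat h y x p.1 p.2 s i j - L p @[p --> F] --> 0.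
  pose proof (cvgD (cvgD (GD j) (GD i)) GDD) as bnd; rewrite !addr0 in bnd.
  apply: cvg0_dominated bnd; apply: (filterS _ near_Rhat_neq0) => p r0.
  exact: Chat_dev_le.
pose proof (cvgD CL (@cvg_lagprod_avg s i j sh)) as Cl; rewrite add0r in Cl.
by apply: (cvg_near_eq Cl); apply: nearW => p; rewrite /= subrK.
Qed.

Hypothesis h_gt0 : (0 < h)%N.

Lemma cvg_VIhat : opnorm (VIhat h y x p.1 p.2) @[p --> F] -->
  opnorm (VI P h y x beta).
Proof.
have C0 i j : Chat h y x p.1 p.2 0 i j @[p --> F] --> Cpop P h y x beta 0 i j.
  exact: cvg_Chat.
have CS s i j : (s < h)%N ->
    Chat h y x p.1 p.2 s i j + Chat h y x p.1 p.2 s j i @[p --> F] -->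
    Cpop P h y x beta s i j + Cpop P h y x beta s j i.
  by move=> sh; apply: cvgD; exact: cvg_Chat.
have VIij i j : VIhat h y x p.1 p.2 i j @[p --> F] --> VI P h y x beta i j.
  pose c (s : nat) (p : nat * T) : R := if (s < h)%N then
    Chat h y x p.1 p.2 s i j + Chat h y x p.1 p.2 s j i else 0.
  pose cl (s : nat) : R := if (s < h)%N then
    Cpop P h y x beta s i j + Cpop P h y x beta s j i else 0.
  have ccl s : c s @ F --> cl s.
    rewrite /c /cl; case: ifPn => [sh|_]; first exact: CS.
    exact: cvg_cst.
  have -> : VI P h y x beta i j = (Rpop P x)^-1 *
      (Cpop P h y x beta 0 i j + \sum_(1 <= s < h) cl s).
    rewrite mxE mxE summxE; congr (_ * (_ + _)).
    by apply: eq_big_nat => s /andP[_ sh]; rewrite mxE [_^T _ _]mxE /cl sh.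
  pose proof (cvgM cvg_Rhat_inv
    (cvgD (C0 i j) (cvg_finite_sum (r := index_iota 1 h) ccl))) as Vl.
  apply: (cvg_near_eq Vl); apply: nearW => p.
  rewrite mxE mxE summxE; congr (_ * (_ + _)).
  by apply: eq_big_nat => s /andP[_ sh]; rewrite mxE [_^T _ _]mxE /c sh.
apply/subr_cvg0; have V0 : 1 * (opnorm (VIhat h y x p.1 p.2) -
    opnorm (VI P h y x beta)) @[p --> F] --> 0.
  apply: (@cvg_opnorm _ _ _ _ _ _ _ _ (fun=> 1)) => i j.
  apply: (@cvg_near_eq _ _ _ _ _ _ _ ((subr_cvg0 _ _).2 (VIij i j))).
  by apply: nearW => p; rewrite mul1r.
by apply: (cvg_near_eq V0); apply: nearW => p; rewrite mul1r.
Qed.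

Lemma cvg_MIhat (alpha : nat -> R) :
  alpha n / Num.sqrt n%:R @[n --> \oo] --> +oo ->
  p.1%:R / alpha p.1 *
    (opnorm (MIhat h y x p.1 p.2) - opnorm (MI P h y x beta)) @[p --> F] --> 0.
Proof.
move=> /(cvg_penalty_rate h) a0.
have sqrtV0 : 1 / Num.sqrt (n - h)%:R @[n --> \oo] --> (0 : R).
  under eq_cvg do rewrite div1r.
  by apply: cvg_inv_pinfty; apply: cvg_sqrt_pinfty; exact: cvg_natr_subn.
apply: (@cvg_opnorm _ _ _ _ _ _ _ _ (fun p => p.1%:R / alpha p.1)) => i j.
pose proof (cvgB (@cvg_err2_avg (fun n => n%:R / alpha n) i j a0)
  (cvgM cvg_Rhat_inv (cvgM (@cvg_score (fun n => n%:R / alpha n) i a0)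
    (@cvg_score (fun=> 1) j sqrtV0)))) as M0.
rewrite mulr0 mulr0 subr0 in M0.
apply: (cvg_near_eq M0); apply: (filterS _ near_Rhat_neq0) => p r0.
rewrite (@MIhatE _ _ _ _ _ y x beta)// !fctE /= -/(r p); ring.
Qed.

(** The sampling error of [MIhat] has order [n^-1/2], below the penalty weight
    [alpha n / n], so at the scale of that weight only the penalty survives. *)
Lemma cvg_VMRIChat (alpha : nat -> R) :
  alpha n / Num.sqrt n%:R @[n --> \oo] --> +oo ->
  p.1%:R / alpha p.1 *
    (VMRIChat h y x p.1 p.2 alpha - opnorm (MI P h y x beta)) @[p --> F] -->
  opnorm (VI P h y x beta).
Proof.
move=> aoo; pose proof (cvgD (cvg_MIhat aoo) cvg_VIhat) as V; rewrite add0r in V.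
apply: (cvg_near_eq V).
have an : \forall n \near \oo, 0 < alpha n / Num.sqrt n%:R.
  by move/cvgryPgt : aoo; apply.
have aF : \forall p \near F, 0 < alpha p.1 / Num.sqrt p.1%:R.
  exact: (@cvg_inprob_fst _ _ _ P _ an).
apply: (filterS _ (filterI aF (near_inprob_gt P h))) => p [ap hp] /=.
have n0 : 0 < p.1%:R :> R by rewrite ltr0n; lia.
have a0 : 0 < alpha p.1.
  by move: ap; rewrite pmulr_lgt0// invr_gt0 sqrtr_gt0.
rewrite /VMRIChat opnormZ ger0_norm ?divr_ge0 ?ltW// addrAC mulrDr.
by congr (_ + _); rewrite mulrA mulrA divfK ?gt_eqF// divff ?mul1r// gt_eqF.
Qed.

End Consistency.

(** * Selection by a penalized criterion *)

Lemma argmin_nonempty (R : realType) (I : finType) (A : set I) (f : I -> R) :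
  A !=set0 -> argmin A f !=set0.
Proof.
move=> [i Ai]; have Pi : `[< A i >] by exact/asboolP.
have [j /asboolP Aj jmin] := @arg_minP _ _ _ i (fun k => `[< A k >]) f Pi.
by exists j; split => // k Ak; apply: jmin; exact/asboolP.
Qed.

(** If [Q i = g i + (v i + o(1)) / c] with [c] tending to infinity, differences of
    [g] dominate, and [v] decides between indices with equal [g]: a fixed
    lexicographic minimizer [k] strictly beats every index that is not one. *)
Lemma near_lexicographic_argmin (T : Type) (R : realType) (F : set_system T)
    {FF : Filter F} (I : finType) (Q : I -> T -> R) (c : T -> R) (g v : I -> R) :
  (\forall p \near F, 0 < c p) -> (c p)^-1 @[p --> F] --> 0 ->
  (forall i, c p * (Q i p - g i) @[p --> F] --> v i) ->
  \forall p \near F, forall i,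
    argmin setT (Q^~ p) i -> argmin (argmin setT g) v i.
Proof.
move=> c0 cV cQ.
have [[i0]|noI] := pselect (inhabited I); last first.
  by apply: nearW => p i; exfalso; apply: noI.
have [k [[_ kg] kv]] : argmin (argmin setT g) v !=set0.
  by do 2 apply: argmin_nonempty; exists i0.
have Qg i : Q i p @[p --> F] --> g i.
  pose proof (cvgD (cvgM cV (cQ i)) (cvg_cst (g i))) as Qi.
  rewrite mul0r add0r in Qi; apply: (cvg_near_eq Qi).
  apply: (filterS _ c0) => p cp; rewrite !fctE /= mulrA mulVf ?gt_eqF//.
  by rewrite mul1r subrK.
have beats i : \forall p \near F,
    ~ argmin (argmin setT g) v i -> Q k p < Q i p.
  have [iM|iM] := pselect (argmin (argmin setT g) v i).
    by apply: nearW => p /(_ iM).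
  have [gki|gik] := ltP (g k) (g i).
    have m1 : g k < (g k + g i) / 2 by rewrite midf_lt.
    have m2 : (g k + g i) / 2 < g i by rewrite midf_lt.
    have ltm := cvgr_lt _ (Qg k) _ m1; have gtm := cvgr_gt _ (Qg i) _ m2.
    apply: (filterS _ (filterI (ltm _) (gtm _))) => p [ki im] _.
    exact: lt_trans ki im.
  have gE : g i = g k by apply/eqP; rewrite eq_le gik kg.
  have iM1 : argmin setT g i by split => // l _; rewrite gE; exact: kg.
  have vki : v k < v i.
    rewrite ltNge; apply/negP => vik; apply: iM; split => // l lM.
    exact: le_trans vik (kv _ lM).
  have m1 : v k < (v k + v i) / 2 by rewrite midf_lt.
  have m2 : (v k + v i) / 2 < v i by rewrite midf_lt.
  have ltm := cvgr_lt _ (cQ k) _ m1; have gtm := cvgr_gt _ (cQ i) _ m2.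
  apply: (filterS _ (filterI c0 (filterI (ltm _) (gtm _)))).
  move=> p [cp [km mi]] _; have := lt_trans km mi.
  by rewrite ltr_pM2l// gE ltrD2r.
apply: (filterS _ (filter_forall _ beats)) => p bp i [_ ip].
apply: contrapT => /bp; rewrite ltNge => /negP; apply; exact: ip.
Qed.

Lemma measurable_selection (d : measure_display) (T : measurableType d)
    (I : finType) (s : T -> I) (A : set I) :
  (forall i, measurable [set om | s om = i]) -> measurable [set om | A (s om)].
Proof.
move=> ms.
have -> : [set om | A (s om)] =
    \bigcup_i (if `[< A i >] then [set om | s om = i] else set0).
  apply/seteqP; split => [om /= As|om [i _]].
    by exists (s om) => //; rewrite asboolT.
  by case: asboolP => //= Ai ->.
apply: countable_bigcupT_measurable => [|i]; first exact: countableP.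
by case: ifP.
Qed.

Unset Implicit Arguments.
Set Strict Implicit.

Theorem theorem3
  (d : measure_display) (T : measurableType d) (R : realType)
  (P : probability T R)
  (h w K : nat) (h_ge1 : (1 <= h)%N) (w_ge2 : (2 <= w)%N) (K_ge1 : (1 <= K)%N)
  (y : int -> T -> 'cV[R]_w)
  (y_stationary : weakly_stationary P y) (y_mean0 : mean_zero P y)
  (x : 'I_K -> int -> T -> R)
  (x_stationary : forall l : 'I_K,
     weakly_stationary P (fun t om => const_mx (x l t om) : 'cV[R]_1))
  (x_mean0 : forall l : 'I_K,
     mean_zero P (fun t om => const_mx (x l t om) : 'cV[R]_1))
  (beta : 'I_K -> 'cV[R]_w)
  (R_neq0 : forall l : 'I_K, Rpop P (x l) <> 0)
  (moments_invariant : forall l : 'I_K,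
     time_invariant_moments P h y (x l) (beta l))
  (cond1 : forall l : 'I_K,
     is_Op P
       (fun n om =>
          opnorm (n%:R^-1 *:
                    \sum_(1 <= t < n.+1) err2 h y (x l) (beta l) t%:Z om
                  - MI P h y (x l) (beta l)))
       (fun n => (Num.sqrt n%:R)^-1))
  (cond2 : forall (l : 'I_K) (s : nat), (s <= h - 1)%N ->
     is_op P
       (fun n om =>
          opnorm (n%:R^-1 *:
                    \sum_(1 <= t < n.+1) lagprod h y (x l) (beta l) s t%:Z om
                  - Cpop P h y (x l) (beta l) s))
       (fun=> 1))
  (cond3 : forall l : 'I_K,
     is_Op P
       (fun n om =>
          enorm ((Num.sqrt n%:R)^-1 *:
                   \sum_(1 <= t < n.+1)
                     x l t%:Z om *: err h y (x l) (beta l) t%:Z om))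
       (fun=> 1))
  (cond4 : forall l : 'I_K,
     is_op P
       (fun n om =>
          `| n%:R^-1 * (\sum_(1 <= t < n.+1) x l t%:Z om ^+ 2)
             - Rpop P (x l) |)
       (fun=> 1))
  (cond5 : forall l : 'I_K,
     (ereal_sup [set expectation P
                    (fun om => enorm (err h y (x l) (beta l) t om) ^+ 4)%R
                | t in [set: int]]
      + ereal_sup [set expectation P (fun om => `| x l t om | ^+ 4)%R | t in [set: int]]
      < +oo)%E)
  (alpha : nat -> R)
  (alpha_large : alpha n / Num.sqrt n%:R @[n --> \oo] --> +oo)
  (alpha_small : alpha n / n%:R @[n --> \oo] --> 0)
  (lhat : nat -> T -> 'I_K)
  (lhat_measurable : forall (n : nat) (k : 'I_K),
     measurable [set om | lhat n om = k])
  (* the selector is constrained only where the criterion is defined: positive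
     sample sizes N - s for all s < h, and invertible Rhat *)
  (lhat_minimizer : forall (n : nat) (om : T), (2 * h <= n)%N ->
     (forall l : 'I_K, Rhat h (x l) n om <> 0) ->
     argmin [set: 'I_K] (fun l => VMRIChat h y (x l) n om alpha) (lhat n om)) :
  let M1 := argmin [set: 'I_K] (fun l => opnorm (MI P h y (x l) (beta l))) in
  let M2 := argmin M1 (fun l => opnorm (VI P h y (x l) (beta l))) in
  P [set om | M2 (lhat n om)] @[n --> \oo] --> 1%E.
Proof.
move=> M1 M2.
have mLfun (f : T -> R) : f \in Lfun P 2%:E -> measurable_fun setT f.
  by move=> /sub_Lfun_mfun; rewrite inE.
have my t i : measurable_fun setT (fun om => y t om i 0).
  by apply: mLfun; case: y_stationary.
have mx l t : measurable_fun setT (x l t).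
  have [xL _ _] := x_stationary l; have := mLfun _ (xL t 0).
  by under eq_fun do rewrite mxE.
apply: (@inprob_prob1 _ _ _ P (fun n => [set om | M2 (lhat n om)])) => [n|].
  by apply: measurable_selection.
have alpha_gt0 : \forall n \near \oo, 0 < alpha n / Num.sqrt n%:R.
  by move/cvgryPgt : alpha_large; apply.
have c0 : \forall p \near inprob P, 0 < p.1%:R / alpha p.1.
  have := @cvg_inprob_fst _ _ _ P _ alpha_gt0.
  have := near_inprob_gt P 0.
  move=> n0 a0; apply: (filterS _ (filterI n0 a0)) => p [np ap].
  have sp : 0 < Num.sqrt p.1%:R :> R by rewrite sqrtr_gt0 ltr0n.
  have al : 0 < alpha p.1 by move: ap => /=; rewrite pmulr_lgt0 ?invr_gt0.
  by rewrite divr_gt0// ltr0n.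
have cV : (p.1%:R / alpha p.1)^-1 @[p --> inprob P] --> 0.
  apply: (cvg_near_eq (inprob_det P alpha_small)); apply: nearW => p.
  by rewrite invf_div.
have near2h : \forall p \near inprob P, (2 * h <= p.1)%N.
  by apply: (filterS _ (near_inprob_gt P (2 * h))) => p /ltnW.
have nearR : \forall p \near inprob P, forall l, Rhat h (x l) p.1 p.2 <> 0.
  apply: filter_forall => l.
  have Rl := near_Rhat_neq0 h (mx l) (@R_neq0 l) (cond4 l).
  by apply: (filterS _ Rl) => p /eqP.
have cQ l := cvg_VMRIChat my (mx l) (@R_neq0 l) (cond1 l) (cond2 l)
  (cond3 l) (cond4 l) (cond5 l) h_ge1 alpha_large.
pose proof (near_lexicographic_argmin c0 cV cQ) as sel.
apply: (filterS _ (filterI sel (filterI near2h nearR))) => p [selp [hp rp]].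
by apply: selp; exact: lhat_minimizer.
Qed.
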